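(* Let $\gamma=\{\gamma_{ij}\}_{i,j\ge 0}$ be a recursive doubly indexed sequence (RDIS) associated with the characteristic polynomial $P(z,\bar z)=z^{r}-\sum_{0\le l+k\le r-1}a_{lk}\bar z^{l}z^{k}$, and let $Z(P)=\{w\in\mathbb{C}: P(w,\bar w)=0\}=\{\lambda_1,\lambda_2,\dots,\lambda_n\}$ (a finite set). Let $\xi=2r-2-\alpha_c$, where $\alpha_c$ is the quantity described in the context. Then the following are equivalent: (1) $\gamma$ is a moment sequence; (2) $Q(z)=\prod_{i=1}^n(z-\lambda_i)\in\mathcal{P}_\gamma$ and $M(\xi)(\gamma)\ge 0$.
   Context: $\mathbb{C}[z,\bar z]$ is the ring of polynomials in two commuting indeterminates $z,\bar z$, with conjugation $p=\sum p_{lk}\bar z^lz^k\mapsto \bar p=\sum\overline{p_{lk}}\,\bar z^{k}z^{l}$; $p$ is evaluated at $w\in\mathbb{C}$ as $p(w,\bar w)$. RDIS: a sequence $\gamma=\{\gamma_{ij}\}_{i,j\ge0}$ of complex numbers with $\gamma_{00}>0$ and $\gamma_{ji}=\overline{\gamma_{ij}}$ is an RDIS associated with the characteristic polynomial $P=z^{r}-\sum_{0\le l+k\le r-1}a_{lk}\bar z^lz^k$ if $\gamma_{i,j+r}=\sum_{0\le l+k\le r-1}a_{lk}\gamma_{i+l,j+k}$ for all $i,j\ge0$. $\mathcal{P}_\gamma$ is the set of characteristic polynomials of $\gamma$, i.e. of all $p=\sum p_{lk}\bar z^lz^k\in\mathbb{C}[z,\bar z]$ with $\sum p_{lk}\gamma_{i+l,j+k}=0$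 for all $i,j\ge0$. $M(n)(\gamma)$ is the moment matrix with rows and columns indexed by the monomials $\bar z^iz^j$, $i+j\le n$, whose entry in row $\bar z^kz^l$, column $\bar z^iz^j$ is $\gamma_{i+l,j+k}$. $\ge0$ means positive semidefinite. $\gamma$ is a moment sequence if there is a positive Borel measure $\mu$ on $\mathbb{C}$ with $\gamma_{ij}=\int\bar z^iz^j\,d\mu$ for all $i,j\ge0$. The quantity $\alpha_c$: let $h\in\mathbb{C}[z,\bar z]$ be a polynomial with degree in $z$ less than $r$ and degree in $\bar z$ less than $r$ such that $Q=h+f_1P+f_2\bar P$ for some $f_1,f_2\in\mathbb{C}[z,\bar z]$. Let $d_h$ be the total degree of $h$ and $A_h$ the set of monomials $\bar z^iz^j$ in $h$ with $i+j=d_h$. Put $c_1=\max\{k:\bar z^lz^k\in A_h\}$ and $c_1'=\max\{l:\bar z^lz^k\in A_h\}$. If $\operatorname{card}A_h\ge2$ put $c_2=\max\{k:\bar z^lz^k\in A_h\setminus\{\bar z^{d_h-c_1}z^{c_1}\}\}$ and $c_2'=\max\{l:\bar z^lz^k\in A_h\setminus\{\bar z^{c_1'}z^{d_h-c_1'}\}\}$; if $\operatorname{card}A_h=1$ put $c_2=c_2'=-\infty$. Let $c=\sup(c_1,c_1')$, $\alpha_{c_1}=\inf(r-c_1,c_1-c_2)$ and $\alpha_{c_1'}=\inf(r-c_1',c_1'-c_2')$; $\alpha_c$ is $\alpha_{c_1}$ when $c=c_1$ and $\alpha_{c_1'}$ when $c=c_1'$. *)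

(* Defs.v *)
From HB Require Import structures.
From mathcomp Require Import all_boot all_order all_algebra.
From mathcomp Require Import polyXY complex.
Set Implicit Arguments.
Unset Strict Implicit.
Unset Printing Implicit Defensive.
Import Order.TTheory GRing.Theory Num.Theory.
Local Open Scope ring_scope.

(* An element p of C[z, zbar] is a p : {poly {poly C}}, where z is the outer variable 'X and
   zbar the inner one 'Y = 'X%:P; hence deg_z p < r is size p <= r and
   deg_zbar p < r is sizeY p <= r. *)

Section BivariatePolynomials.
Variable C : numClosedFieldType.
Implicit Types (p h : {poly {poly C}}) (gamma a : nat -> nat -> C).

(* The coefficient p_lk of zbar^l z^k. *)
Definition bicoef p (l k : nat) : C := p`_k`_l.

Definition conj_bipoly p : {poly {poly C}} :=
  swapXY (map_poly (map_poly Num.conj) p).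

Definition eval_bipoly p (w : C) : C := p.[w, w^*].

Definition rdis_poly (r : nat) a : {poly {poly C}} :=
  'X^r - \sum_(l < r) \sum_(k < r | (l + k < r)%N) (a l k)%:P *: ('Y ^+ l * 'X^k).

(* In the order of C, 0 < x means that x is real and positive. *)
Definition rdis (r : nat) a gamma : Prop :=
  [/\ 0 < gamma 0%N 0%N,
      forall i j, gamma j i = (gamma i j)^*
    & forall i j, gamma i (j + r)%N =
        \sum_(l < r) \sum_(k < r | (l + k < r)%N)
           a l k * gamma (i + l)%N (j + k)%N].

Definition characteristic_poly gamma p : Prop :=
  forall i j : nat,
    \sum_(k < size p) \sum_(l < size p`_k)
       bicoef p l k * gamma (i + l)%N (j + k)%N = 0.

(* The pair (i, j) stands for the monomial zbar^i z^j. *)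
Definition monomials (n : nat) : {set 'I_n.+1 * 'I_n.+1} :=
  [set m : 'I_n.+1 * 'I_n.+1 | (m.1 + m.2 <= n)%N].

Definition moment_matrix (n : nat) gamma : 'M[C]_#|monomials n| :=
  \matrix_(s < #|monomials n|, t < #|monomials n|)
    let row : 'I_n.+1 * 'I_n.+1 := enum_val s in
    let col : 'I_n.+1 * 'I_n.+1 := enum_val t in
    gamma (col.1 + row.2)%N (col.2 + row.1)%N.

(* In the order of C, 0 <= x entails that x is real; hence a matrix satisfying
   this condition is Hermitian. *)
Definition psd (m : nat) (M : 'M[C]_m) : Prop :=
  forall v : 'cV[C]_m, 0 <= ((map_mx Num.conj v)^T *m M *m v) 0 0.

Definition total_degree h : nat :=
  \max_(k < size h) \max_(l < sizeY h | bicoef h l k != 0%R) (l + k).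

(* The set A_h; the pair (l, k) stands for the monomial zbar^l z^k. *)
Definition top_monomials h :
    {set 'I_(total_degree h).+1 * 'I_(total_degree h).+1} :=
  [set m : 'I_(total_degree h).+1 * 'I_(total_degree h).+1 |
    ((m.1 + m.2)%N == total_degree h) && (bicoef h m.1 m.2 != 0)].

Definition c1 h : nat := \max_(m in top_monomials h) m.2.
Definition c1' h : nat := \max_(m in top_monomials h) m.1.

(* c2 and c2' are used only when A_h has at least two elements; otherwise they
   are -oo in the definition of alpha_c. *)
Definition c2 h : nat :=
  \max_(m in top_monomials h |
      (m.1 : nat, m.2 : nat) != ((total_degree h - c1 h)%N, c1 h)) m.2.
Definition c2' h : nat :=
  \max_(m in top_monomials h |
      (m.1 : nat, m.2 : nat) != (c1' h, (total_degree h - c1' h)%N)) m.1.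

(* When card A_h = 1, inf (r - c1, c1 - (-oo)) = r - c1. *)
Definition alpha_c1 (r : nat) h : nat :=
  if (2 <= #|top_monomials h|)%N then minn (r - c1 h) (c1 h - c2 h)
  else (r - c1 h)%N.
Definition alpha_c1' (r : nat) h : nat :=
  if (2 <= #|top_monomials h|)%N then minn (r - c1' h) (c1' h - c2' h)
  else (r - c1' h)%N.

(* If c1 = c1' then both alpha_c1 and alpha_c1' are admissible values of
   alpha_c; they may differ. If h = 0 then A_h is empty and c1, c1' make no
   sense; the convention is alpha_c = 0. *)
Definition is_alpha_c (r : nat) h (alpha : nat) : Prop :=
  if h == 0 then alpha = 0%N
  else let c := maxn (c1 h) (c1' h) in
       (c = c1 h /\ alpha = alpha_c1 r h) \/
       (c = c1' h /\ alpha = alpha_c1' r h).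

End BivariatePolynomials.

From mathcomp Require Import all_classical all_reals all_analysis.
Import numFieldNormedType.Exports.
Local Open Scope classical_set_scope.

Definition zero_set (C : numClosedFieldType) (p : {poly {poly C}}) : set C :=
  [set w | eval_bipoly p w = 0].

(* C with its Borel sigma-algebra; R[i]^o is R[i] with the topology of the
   complex modulus. *)
Notation borelC R := (g_sigma_algebraType (@open (R[i])^o)).

Definition is_complex_integral (R : realType)
    (mu : {measure set (borelC R) -> \bar R}) (f : R[i] -> R[i]) (I : R[i]) :=
  [/\ mu.-integrable setT (fun w : borelC R => (complex.Re (f w))%:E),
      mu.-integrable setT (fun w : borelC R => (complex.Im (f w))%:E)
    & I = (Rintegral mu setT (fun w : borelC R => complex.Re (f w)) +i*
           Rintegral mu setT (fun w : borelC R => complex.Im (f w)))%C].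

Definition moment_sequence (R : realType) (gamma : nat -> nat -> R[i]) : Prop :=
  exists mu : {measure set (borelC R) -> \bar R},
    forall i j : nat,
      is_complex_integral mu (fun w => w^* ^+ i * w ^+ j) (gamma i j).

(* Main.v *)
Require Import Defs.
From HB Require Import structures.
From mathcomp Require Import all_boot all_order all_algebra.
From mathcomp Require Import polyXY complex zify lra.
From mathcomp Require Import all_classical all_reals all_analysis measurable_realfun.
Set Implicit Arguments.
Unset Strict Implicit.
Unset Printing Implicit Defensive.
Import Order.TTheory GRing.Theory Num.Theory.
Import numFieldNormedType.Exports.
Local Open Scope classical_set_scope.
Local Open Scope ring_scope.

(* Let L be the Riesz functional zbar^l z^k |-> gamma_lk; the characteristic
   polynomials are the ideal I of all p with L (p q) = 0 for every q, and I is
   stable under conjugation.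

   If mu represents gamma, then the integral of |P|^2 is L (P Pbar) = 0, so mu
   lives on Z(P), where Q vanishes; hence L (Q q) = 0 for every q.

   Conversely, modulo I the relations P and Pbar lower the degree of every
   monomial zbar^l z^k with k >= r or l >= r.  The gap alpha_c makes h, which
   also lies in I, do the same when l, k < r and l + k > xi: after multiplying
   the leading monomial of h up to zbar^l z^k, every other top-degree term has
   an exponent >= r.  So positivity of M(xi) gives L (q qbar) >= 0 for all q.
   As Q and Qbar lie in I, Lagrange interpolation writes L as a combination
   W_ij of evaluations at the points (lambda_i, conj lambda_j), and positivity
   kills W_ij for i <> j and makes W_ii >= 0: gamma is represented by an atomic
   measure on Z(P). *)

Lemma sum_ord_widen (V : nmodType) (F : nat -> V) m n : (m <= n)%N ->
  (forall i, (m <= i)%N -> F i = 0) -> \sum_(i < m) F i = \sum_(i < n) F i.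
Proof.
move=> le_mn F0; rewrite (big_ord_widen _ F le_mn) big_mkcond /=.
by apply: eq_bigr => i _; case: ltnP => // /F0.
Qed.

(** * The Riesz functional and the ideal of characteristic polynomials *)

Section Riesz.
Variable C : numClosedFieldType.
Implicit Types (p q h : {poly {poly C}}) (gamma a : nat -> nat -> C) (c : C).

Definition bimon (l k : nat) : {poly {poly C}} := 'Y ^+ l * 'X^k.

Definition riesz gamma p : C :=
  \sum_(k < size p) \sum_(l < size p`_k) bicoef p l k * gamma l k.

Lemma bimonM l k i j : bimon l k * bimon i j = bimon (l + i) (k + j).
Proof. by rewrite /bimon mulrACA -!exprD. Qed.

Lemma bimon00 : bimon 0 0 = 1.
Proof. by rewrite /bimon !expr0 mulr1. Qed.

Lemma bicoef_bimon c i j l k :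
  bicoef (c%:P%:P * bimon i j) l k = c *+ ((l == i) && (k == j)).
Proof.
rewrite /bicoef /bimon -rmorphXn /= !coefCM coefXn.
by case: eqP => _; rewrite ?andbF ?andbT ?mulr1 ?mulr0 ?coefXn ?coef0 ?mulr0 ?mulr_natr.
Qed.

Lemma bipoly_expand p : p = \sum_(k < size p) \sum_(l < size p`_k)
  (bicoef p l k)%:P%:P * bimon l k.
Proof.
rewrite -[LHS]coefK poly_def; apply: eq_bigr => k _.
rewrite -[X in X *: _]coefK poly_def scaler_suml; apply: eq_bigr => l _.
by rewrite /bimon -!mul_polyC -/('Y) mulrA rmorphM rmorphXn.
Qed.

(** Scaled monomials span additively, so identities that are additive in the polynomial need
    checking on them only; this is how conjugation, evaluation and [riesz] are compared below. *)
Lemma bipoly_ind (K : {poly {poly C}} -> Prop) :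
  K 0 -> (forall p q, K p -> K q -> K (p + q)) ->
  (forall c l k, K (c%:P%:P * bimon l k)) -> forall p, K p.
Proof.
move=> K0 KD Km p; rewrite [p]bipoly_expand.
by elim/big_rec: _ => // k q _ Kq; apply: (KD _ _ _ Kq); elim/big_rec: _ => // *; apply: KD.
Qed.

(** Ranges that may exceed the sizes of [p] let two polynomials share one range, so that linearity
    becomes a coefficientwise statement. *)
Lemma riesz_widen gamma p N M : (size p <= N)%N ->
    (forall k, (size (p`_k)%R <= M)%N) ->
  riesz gamma p = \sum_(k < N) \sum_(l < M) bicoef p l k * gamma l k.
Proof.
move=> leN leM; have inner k :
    \sum_(l < size p`_k) bicoef p l k * gamma l k = \sum_(l < M) bicoef p l k * gamma l k.
  apply: (sum_ord_widen (F := fun l => bicoef p l k * gamma l k)) => // i /leq_sizeP E.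
  by rewrite /bicoef E ?mul0r.
rewrite /riesz; under eq_bigr do rewrite inner.
apply: (sum_ord_widen (F := fun k => \sum_(l < M) bicoef p l k * gamma l k)) => // k le.
by rewrite big1 // => l _; rewrite /bicoef [p`_k]nth_default // coef0 mul0r.
Qed.

Lemma rieszD gamma p q : riesz gamma (p + q) = riesz gamma p + riesz gamma q.
Proof.
pose N := maxn (size p) (size q); pose M := maxn (sizeY p) (sizeY q).
have lepM k : (size (p`_k)%R <= M)%N.
  by apply: leq_trans (max_size_coefXY _ _) (leq_maxl _ _).
have leqM k : (size (q`_k)%R <= M)%N.
  by apply: leq_trans (max_size_coefXY _ _) (leq_maxr _ _).
rewrite !(@riesz_widen _ _ N M) ?leq_maxl ?leq_maxr //.
- rewrite -big_split; apply: eq_bigr => k _; rewrite -big_split.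
  by apply: eq_bigr => l _; rewrite /bicoef !coefD mulrDl.
- exact: size_polyD.
- move=> k; rewrite coefD; apply: leq_trans (size_polyD _ _) _.
  by rewrite geq_max lepM leqM.
Qed.

Lemma riesz0 gamma : riesz gamma 0 = 0.
Proof. by rewrite /riesz size_poly0 big_ord0. Qed.

Lemma rieszZ gamma c p : riesz gamma (c%:P%:P * p) = c * riesz gamma p.
Proof.
rewrite !(@riesz_widen _ _ (size p) (sizeY p)) // => [|k||k]; last 1 first.
- by rewrite coefCM; apply: leq_trans (max_size_coefXY p k); rewrite mul_polyC size_scale_leq.
- rewrite mulr_sumr; apply: eq_bigr => k _; rewrite mulr_sumr.
  by apply: eq_bigr => l _; rewrite /bicoef !coefCM mulrA.
- exact: max_size_coefXY.
- by rewrite mul_polyC size_scale_leq.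
Qed.

Lemma riesz_bimon gamma l k : riesz gamma (bimon l k) = gamma l k.
Proof.
have E x y : bicoef (bimon l k) x y = ((x == l) && (y == k))%:R.
  by rewrite -[bimon l k]mul1r -[1 in LHS]/(1%:P%:P) bicoef_bimon.
rewrite (@riesz_widen _ _ k.+1 l.+1) => [||j].
- rewrite (bigD1 ord_max) //= (bigD1 ord_max) //= E !eqxx mul1r.
  rewrite big1 ?addr0 => [|x neq]; last first.
    by move: neq; rewrite -(inj_eq val_inj) E /= => /negPf->; rewrite mul0r.
  rewrite big1 ?addr0 // => y neq; rewrite big1 // => x _.
  by rewrite E; move: neq; rewrite -(inj_eq val_inj) /= => /negPf->; rewrite andbF mul0r.
- by apply/leq_sizeP => j lt; apply/polyP => x; rewrite coef0 [LHS]E (gtn_eqF lt) andbF.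
- by apply/leq_sizeP => x lt; rewrite [LHS]E (gtn_eqF lt).
Qed.

Lemma riesz_sum gamma I (s : seq I) (B : pred I) (F : I -> {poly {poly C}}) :
  riesz gamma (\sum_(i <- s | B i) F i) = \sum_(i <- s | B i) riesz gamma (F i).
Proof. by apply: big_morph; [exact: rieszD | exact: riesz0]. Qed.

Lemma rieszN gamma p : riesz gamma (- p) = - riesz gamma p.
Proof. by rewrite -mulN1r -[1]/(1%:P%:P) -!polyCN rieszZ mulN1r. Qed.

(** The recurrence with shift (i, j) says that the functional kills [p * bimon i j], and these
    monomials span. In this form the characteristic polynomials are visibly an ideal. *)
Lemma characteristicP gamma p :
  characteristic_poly gamma p <-> (forall q, riesz gamma (p * q) = 0).
Proof.
have E i j : \sum_(k < size p) \sum_(l < size p`_k)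
    bicoef p l k * gamma (i + l)%N (j + k)%N = riesz gamma (p * bimon i j).
  rewrite [p in RHS]bipoly_expand mulr_suml riesz_sum; apply: eq_bigr => k _.
  rewrite mulr_suml riesz_sum; apply: eq_bigr => l _.
  by rewrite -mulrA bimonM rieszZ riesz_bimon addnC (addnC j).
split=> [cp q|cp i j]; last by rewrite E.
elim/bipoly_ind: q => [|q1 q2 E1 E2|c l k]; first by rewrite mulr0 riesz0.
- by rewrite mulrDr rieszD E1 E2 addr0.
- by rewrite mulrCA rieszZ -E cp mulr0.
Qed.

Lemma characteristicD gamma p q : characteristic_poly gamma p ->
  characteristic_poly gamma q -> characteristic_poly gamma (p + q).
Proof.
move=> /characteristicP cp /characteristicP cq; apply/characteristicP => s.
by rewrite mulrDl rieszD cp cq addr0.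
Qed.

Lemma characteristicM gamma p q : characteristic_poly gamma p ->
  characteristic_poly gamma (q * p).
Proof.
by move=> /characteristicP cp; apply/characteristicP => s; rewrite mulrAC mulrC cp.
Qed.

Lemma characteristic0 gamma : characteristic_poly gamma 0.
Proof. by apply/characteristicP => q; rewrite mul0r riesz0. Qed.

Lemma characteristicN gamma p : characteristic_poly gamma p ->
  characteristic_poly gamma (- p).
Proof. by move=> cp; rewrite -mulN1r; apply: characteristicM. Qed.

Lemma conj_bipolyD p q : conj_bipoly (p + q) = conj_bipoly p + conj_bipoly q.
Proof. by rewrite /conj_bipoly !rmorphD. Qed.

Lemma conj_bipolyM p q : conj_bipoly (p * q) = conj_bipoly p * conj_bipoly q.
Proof. by rewrite /conj_bipoly !rmorphM. Qed.

Lemma conj_bipolyB p q : conj_bipoly (p - q) = conj_bipoly p - conj_bipoly q.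
Proof. by apply: (addIr (conj_bipoly q)); rewrite -conj_bipolyD !subrK. Qed.

Lemma conj_bipoly0 : conj_bipoly (0 : {poly {poly C}}) = 0.
Proof. by rewrite /conj_bipoly !rmorph0. Qed.

Lemma conj_bipoly_sum I (s : seq I) (B : pred I) (F : I -> {poly {poly C}}) :
  conj_bipoly (\sum_(i <- s | B i) F i) = \sum_(i <- s | B i) conj_bipoly (F i).
Proof. by apply: big_morph; [exact: conj_bipolyD | exact: conj_bipoly0]. Qed.

Lemma conj_bipoly_bimon c l k :
  conj_bipoly (c%:P%:P * bimon l k) = c^*%:P%:P * bimon k l.
Proof.
rewrite /conj_bipoly /bimon !rmorphM !rmorphXn /= !map_polyC /= map_polyC map_polyX /=.
by rewrite swapXY_polyC map_polyC /= swapXY_Y map_polyX swapXY_X [_ ^+ l * _]mulrC.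
Qed.

Lemma conj_bimon l k : conj_bipoly (bimon l k) = bimon k l.
Proof. by rewrite -[bimon l k]mul1r -[1]/(1%:P%:P) conj_bipoly_bimon rmorph1 mul1r. Qed.

Lemma conj_bipolyK : involutive (@conj_bipoly C).
Proof.
elim/bipoly_ind => [|p q Ep Eq|c l k]; first by rewrite !conj_bipoly0.
- by rewrite !conj_bipolyD Ep Eq.
- by rewrite !conj_bipoly_bimon conjCK.
Qed.

Lemma horner2_bimon c l k (x y : C) :
  (c%:P%:P * bimon l k).[x, y] = c * (y ^+ l * x ^+ k).
Proof. by rewrite /bimon !(hornerE, horner_exp). Qed.

(** Stated for independent arguments because evaluations at the points (lambda_i, conj lambda_j)
    with i <> j occur later; conjugation swaps the two arguments. *)
Lemma horner2_conj p (x y : C) : (conj_bipoly p).[x, y] = p.[y^*, x^*]^*.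
Proof.
elim/bipoly_ind: p => [|p q Ep Eq|c l k]; first by rewrite conj_bipoly0 !horner0 rmorph0.
- by rewrite conj_bipolyD !hornerD Ep Eq rmorphD.
- by rewrite conj_bipoly_bimon !horner2_bimon !rmorphM !rmorphXn /= !conjCK [x ^+ _ * _]mulrC.
Qed.

Lemma eval_bipoly_bimon c l k (w : C) :
  eval_bipoly (c%:P%:P * bimon l k) w = c * (w^* ^+ l * w ^+ k).
Proof. exact: horner2_bimon. Qed.

Lemma eval_conj_bipoly p (w : C) : eval_bipoly (conj_bipoly p) w = (eval_bipoly p w)^*.
Proof. by rewrite /eval_bipoly horner2_conj conjCK. Qed.

Section Hermitian.
Variable gamma : nat -> nat -> C.
Hypothesis gammaC : forall i j, gamma j i = (gamma i j)^*.

Lemma riesz_conj p : riesz gamma (conj_bipoly p) = (riesz gamma p)^*.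
Proof.
elim/bipoly_ind: p => [|p q Ep Eq|c l k]; first by rewrite conj_bipoly0 !riesz0 rmorph0.
- by rewrite conj_bipolyD !rieszD Ep Eq rmorphD.
- by rewrite conj_bipoly_bimon !rieszZ !riesz_bimon rmorphM /= -gammaC.
Qed.

Lemma characteristic_conj p :
  characteristic_poly gamma p -> characteristic_poly gamma (conj_bipoly p).
Proof.
move=> /characteristicP cp; apply/characteristicP => q.
by rewrite -[q]conj_bipolyK -conj_bipolyM riesz_conj cp rmorph0.
Qed.

(** The form L(p pbar) depends on p modulo the ideal only: p pbar - q qbar = (p - q) pbar + conj(p -
    q) q, and p - q and its conjugate are both characteristic. *)
Lemma riesz_sqr_congr p q : characteristic_poly gamma (p - q) ->
  riesz gamma (p * conj_bipoly p) = riesz gamma (q * conj_bipoly q).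
Proof.
move=> cpq; have /characteristicP cpq' := characteristic_conj cpq.
move/characteristicP: cpq => cpq.
apply/eqP; rewrite -subr_eq0 -rieszN -rieszD; apply/eqP.
have ->: p * conj_bipoly p - q * conj_bipoly q =
  (p - q) * conj_bipoly p + conj_bipoly (p - q) * q.
  by rewrite conj_bipolyB !mulrBl ![conj_bipoly _ * q]mulrC addrA subrK.
by rewrite rieszD cpq cpq' addr0.
Qed.

End Hermitian.

End Riesz.

(** * Lowering the degree modulo the characteristic polynomials *)

Section Reduction.
Variable C : numClosedFieldType.
Implicit Types (p q h : {poly {poly C}}) (gamma a : nat -> nat -> C) (c : C).

(** Columns, indexed as in [moment_matrix], serve as the coefficient vectors of the polynomials of
    total degree at most [n]. *)
Definition bipoly_of_col n (v : 'cV[C]_#|monomials n|) : {poly {poly C}} :=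
  \sum_t (v t 0)%:P%:P * bimon C (enum_val t).1 (enum_val t).2.

Definition reducible gamma n p : Prop :=
  exists v : 'cV[C]_#|monomials n|, characteristic_poly gamma (p - bipoly_of_col v).

(** The entry of M(n) in row s and column t is the functional at the monomial t times the conjugate
    of the monomial s, so the quadratic form is L(q qbar). *)
Lemma riesz_bipoly_of_col gamma n (v : 'cV[C]_#|monomials n|) :
  riesz gamma (bipoly_of_col v * conj_bipoly (bipoly_of_col v)) =
  ((map_mx Num.conj v)^T *m moment_matrix n gamma *m v) 0 0.
Proof.
rewrite mxE /bipoly_of_col mulr_suml riesz_sum; apply: eq_bigr => t _.
rewrite conj_bipoly_sum mulr_sumr riesz_sum mxE mulr_suml; apply: eq_bigr => s _.
rewrite !mxE conj_bipoly_bimon mulrACA bimonM -rmorphM -rmorphM rieszZ riesz_bimon.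
by rewrite [v t 0 * _]mulrC mulrAC.
Qed.

Lemma bipoly_of_col0 n : bipoly_of_col (0 : 'cV[C]_#|monomials n|) = 0.
Proof. by rewrite /bipoly_of_col big1 // => t _; rewrite mxE !rmorph0 mul0r. Qed.

Lemma reducible_congr gamma n p q :
  characteristic_poly gamma (p - q) -> reducible gamma n q -> reducible gamma n p.
Proof.
move=> cpq [v cv]; exists v.
by rewrite -(subrK q p) -addrA; apply: characteristicD.
Qed.

Lemma reducible0 gamma n : reducible gamma n 0.
Proof. by exists 0; rewrite bipoly_of_col0 subr0; apply: characteristic0. Qed.

Lemma reducibleD gamma n p q :
  reducible gamma n p -> reducible gamma n q -> reducible gamma n (p + q).
Proof.
move=> [v cv] [w cw]; exists (v + w).
have ->: bipoly_of_col (v + w) = bipoly_of_col v + bipoly_of_col w.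
  rewrite /bipoly_of_col -big_split; apply: eq_bigr => t _ /=.
  by rewrite mxE !rmorphD mulrDl.
by rewrite opprD addrACA; apply: characteristicD.
Qed.

Lemma reducibleZ gamma n c p : reducible gamma n p -> reducible gamma n (c%:P%:P * p).
Proof.
move=> [v cv]; exists (c *: v).
have ->: bipoly_of_col (c *: v) = c%:P%:P * bipoly_of_col v.
  rewrite /bipoly_of_col mulr_sumr; apply: eq_bigr => t _.
  by rewrite mxE !rmorphM mulrA.
by rewrite -mulrBr; apply: characteristicM.
Qed.

Lemma reducible_sum gamma n I (s : seq I) (B : pred I) (F : I -> {poly {poly C}}) :
  (forall i, B i -> reducible gamma n (F i)) ->
  reducible gamma n (\sum_(i <- s | B i) F i).
Proof. by move=> rF; elim/big_ind: _ => //; [exact: reducible0 | exact: reducibleD]. Qed.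

Lemma reducible_bimon gamma n l k : (l + k <= n)%N -> reducible gamma n (bimon C l k).
Proof.
move=> le_n.
pose m : 'I_n.+1 * 'I_n.+1 := (inord l, inord k).
have [Em1 Em2] : m.1 = l :> nat /\ m.2 = k :> nat by rewrite /= !inordK //; lia.
have mA : m \in monomials n by rewrite inE Em1 Em2.
pose t := enum_rank_in mA m; exists (delta_mx t 0).
rewrite /bipoly_of_col (bigD1 t) //= big1 => [|s neq_st]; last first.
  by rewrite mxE (negPf neq_st) !rmorph0 mul0r.
rewrite mxE !eqxx mul1r enum_rankK_in // Em1 Em2 addr0 subrr.
exact: characteristic0.
Qed.

Lemma rdis_polyE r a : rdis_poly r a =
  bimon C 0 r - \sum_(l < r) \sum_(k < r | (l + k < r)%N) (a l k)%:P%:P * bimon C l k.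
Proof.
rewrite /rdis_poly /bimon expr0 mul1r; congr (_ - _).
by apply: eq_bigr => l _; apply: eq_bigr => k _; rewrite mul_polyC.
Qed.

Lemma conj_rdis_polyE r a : conj_bipoly (rdis_poly r a) =
  bimon C r 0 - \sum_(l < r) \sum_(k < r | (l + k < r)%N) (a l k)^*%:P%:P * bimon C k l.
Proof.
rewrite rdis_polyE conj_bipolyB conj_bipoly_sum; congr (_ - _).
  exact: conj_bimon.
apply: eq_bigr => l _; rewrite conj_bipoly_sum; apply: eq_bigr => k _.
exact: conj_bipoly_bimon.
Qed.

Lemma rdis_characteristic r a gamma :
  rdis r a gamma -> characteristic_poly gamma (rdis_poly r a).
Proof.
case=> _ _ rec; apply/characteristicP.
elim/bipoly_ind => [|q1 q2 E1 E2|c i j]; first by rewrite mulr0 riesz0.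
  by rewrite mulrDr rieszD E1 E2 addr0.
rewrite mulrCA rieszZ rdis_polyE mulrBl rieszD rieszN bimonM riesz_bimon add0n addnC rec.
rewrite mulr_suml riesz_sum -sumrB big1 ?mulr0 // => l _.
rewrite mulr_suml riesz_sum -sumrB big1 // => k _.
by rewrite -mulrA rieszZ bimonM riesz_bimon addnC (addnC j) subrr.
Qed.

(* The monomial zbar^l0 z^k0 of h plays the role of the one realizing c; the
   hypothesis is symmetric in z and zbar, so it covers both c = c1 and c = c1'. *)
Lemma bimon_reducible gamma r a h l0 k0 alpha n : rdis r a gamma ->
    characteristic_poly gamma h -> (2 * r - 2 - alpha <= n)%N ->
    alpha = 0%N \/
    [/\ bicoef h l0 k0 != 0, (l0 + alpha <= r)%N, (k0 + alpha <= r)%N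
      & forall l k, bicoef h l k != 0 -> (l != l0) || (k != k0) ->
          (l + k < l0 + k0)%N \/
          (l + k = l0 + k0)%N /\ ((l0 + alpha <= l)%N \/ (k0 + alpha <= k)%N)] ->
  forall l k, reducible gamma n (bimon C l k).
Proof.
move=> rg ch le_n hyp l k; have [_ gC _] := rg.
have cP := rdis_characteristic rg; have cPc := characteristic_conj gC cP.
(* Strong induction on the total degree: [IH] covers degrees below d, and the monomial at hand has
   degree at most d. *)
have [d] := ubnP (l + k); elim: d l k => // d IH l k le_d.
(* A multiple of P trades z^r for terms of lower degree. Degree d itself is allowed here, since
   top-degree terms produced by [h] are handled this way at the end. *)
have high_k l' k' : (l' + k' <= d)%N -> (r <= k')%N -> reducible gamma n (bimon C l' k').
  move=> le le_rk; have := characteristicM (bimon C l' (k' - r)) cP.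
  rewrite rdis_polyE mulrBr bimonM addn0 subnK // => /reducible_congr; apply.
  rewrite mulr_sumr; apply: reducible_sum => i _; rewrite mulr_sumr.
  apply: reducible_sum => j lt; rewrite mulrCA bimonM.
  by apply/reducibleZ/IH; lia.
have high_l l' k' : (l' + k' <= d)%N -> (r <= l')%N -> reducible gamma n (bimon C l' k').
  move=> le le_rk; have := characteristicM (bimon C (l' - r) k') cPc.
  rewrite conj_rdis_polyE mulrBr bimonM addn0 subnK // => /reducible_congr; apply.
  rewrite mulr_sumr; apply: reducible_sum => i _; rewrite mulr_sumr.
  apply: reducible_sum => j lt; rewrite mulrCA bimonM.
  by apply/reducibleZ/IH; lia.
have [le_rk|lt_kr] := leqP r k; first exact: high_k.
have [le_rl|lt_lr] := leqP r l; first exact: high_l.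
have [le|lt_n] := leqP (l + k) n; first exact: reducible_bimon.
(* If alpha = 0, then l, k < r already gives l + k <= 2r - 2 <= n, against [lt_n]. *)
case: hyp => [a0|[nz le_l0 le_k0 others]]; first by lia.
pose c0 := bicoef h l0 k0; pose h' := h - c0%:P%:P * bimon C l0 k0.
(* The subtractions are exact: l + k > 2r - 2 - alpha and k < r give l >= r - alpha >= l0, and
   likewise k >= r - alpha >= k0. *)
pose m := bimon C (l - l0) (k - k0).
(* Hence zbar^l z^k is congruent to - c0^-1 h' m, where h' is h without its term at (l0, k0). *)
have E : bimon C l k - (- c0^-1)%:P%:P * (h' * m) = c0^-1%:P%:P * m * h.
  have Em : bimon C l k = c0^-1%:P%:P * (c0%:P%:P * (bimon C l0 k0 * m)).
    by rewrite mulrA -!rmorphM mulVf // mul1r bimonM !subnKC //; lia.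
  rewrite Em !rmorphN mulNr opprK -mulrDr -mulrA; congr (_ * _).
  by rewrite mulrA -mulrDl addrC subrK mulrC.
have := characteristicM (c0^-1%:P%:P * m) ch.
rewrite -E => /reducible_congr; apply; apply: reducibleZ.
rewrite [h']bipoly_expand mulr_suml; apply: reducible_sum => -[j /= _] _.
rewrite mulr_suml; apply: reducible_sum => -[i /= _] _; rewrite -mulrA bimonM.
have [->|nz'] := eqVneq (bicoef h' i j) 0; first by rewrite mul0r; apply: reducible0.
apply: reducibleZ; move: nz'.
have ->: bicoef h' i j = bicoef h i j - c0 *+ ((i == l0) && (j == k0)).
  by rewrite -bicoef_bimon /bicoef /h' !coefB.
have [/andP[/eqP-> /eqP->]|/negPf neq] := boolP ((i == l0) && (j == k0)).
  by rewrite subrr eqxx.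
(* A remaining term of h' m has degree below l + k, or the same degree and an exponent at least r:
   from i >= l0 + alpha follows i + (l - l0) >= l + alpha >= r, and similarly for z. *)
rewrite subr0 => /others[|lt|[eq [le|le]]]; first by rewrite -negb_and neq.
- by apply: IH; lia.
- by apply: high_l; lia.
- by apply: high_k; lia.
Qed.

(** * The leading monomials of h and the gap alpha *)

Lemma bicoef_size h l k : bicoef h l k != 0 -> (l < sizeY h)%N /\ (k < size h)%N.
Proof.
move=> nz; split; rewrite ltnNge; apply: contra nz => le; rewrite /bicoef.
  by rewrite nth_default // (leq_trans (max_size_coefXY h k)).
by rewrite [h`_k]nth_default // coef0.
Qed.

Lemma leq_total_degree h l k : bicoef h l k != 0 -> (l + k <= total_degree h)%N.
Proof.
move=> nz; have [lt_l lt_k] := bicoef_size nz.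
apply: leq_trans (leq_bigmax (Ordinal lt_k)) => /=.
exact: (@leq_bigmax_cond _ _ (fun l : 'I_(sizeY h) => (l + k)%N) (Ordinal lt_l)).
Qed.

(** If no monomial attained the total degree d, all would have degree at most d - 1, and so would
    their maximum d; a nonzero coefficient gives d > 0, which excludes the truncated case d = 0. *)
Lemma top_monomials_gt0 h : h != 0 -> (0 < #|top_monomials h|)%N.
Proof.
move=> h0; rewrite lt0n; apply/negP => /eqP/card0_eq A0.
have lt_d l k : bicoef h l k != 0 -> (l + k < total_degree h)%N.
  move=> nz; rewrite ltn_neqAle leq_total_degree // andbT; apply/negP => /eqP eq_d.
  by have := A0 (inord l, inord k); rewrite !inE /= !inordK; lia.
have : (total_degree h <= (total_degree h).-1)%N.
  apply/bigmax_leqP => k _; apply/bigmax_leqP => l nz; have := lt_d _ _ nz; lia.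
suff [l [k /lt_d]] : exists l k, bicoef h l k != 0 by lia.
exists (size (lead_coef h)).-1, (size h).-1; rewrite /bicoef.
by rewrite -[h`_ _]/(lead_coef h) -[X in X != 0]/(lead_coef (lead_coef h)) !lead_coef_eq0.
Qed.

Lemma top_monomials_mem h l k : bicoef h l k != 0 -> (l + k)%N = total_degree h ->
  ((inord l, inord k) : 'I_(total_degree h).+1 * 'I_(total_degree h).+1)
    \in top_monomials h.
Proof. by move=> nz E; rewrite inE /= !inordK ?E ?eqxx ?nz //; lia. Qed.

Lemma leq_c1 h l k : bicoef h l k != 0 -> (l + k)%N = total_degree h -> (k <= c1 h)%N.
Proof.
move=> nz E; apply: (bigop.bigmax_sup (inord l, inord k)).
  exact: top_monomials_mem.
by rewrite /= inordK; lia.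
Qed.

Lemma leq_c1' h l k : bicoef h l k != 0 -> (l + k)%N = total_degree h -> (l <= c1' h)%N.
Proof.
move=> nz E; apply: (bigop.bigmax_sup (inord l, inord k)).
  exact: top_monomials_mem.
by rewrite /= inordK; lia.
Qed.

Lemma leq_c2 h l k : bicoef h l k != 0 -> (l + k)%N = total_degree h -> k != c1 h ->
  (k <= c2 h)%N.
Proof.
move=> nz E neq; apply: (bigop.bigmax_sup (inord l, inord k)).
  rewrite top_monomials_mem //= !inordK; try lia.
  by apply: contra neq => /eqP[_ ->].
by rewrite /= inordK; lia.
Qed.

Lemma leq_c2' h l k : bicoef h l k != 0 -> (l + k)%N = total_degree h -> l != c1' h ->
  (l <= c2' h)%N.
Proof.
move=> nz E neq; apply: (bigop.bigmax_sup (inord l, inord k)).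
  rewrite top_monomials_mem //= !inordK; try lia.
  by apply: contra neq => /eqP[-> _].
by rewrite /= inordK; lia.
Qed.

Lemma c1_attained h : h != 0 ->
  exists2 l, bicoef h l (c1 h) != 0 & (l + c1 h)%N = total_degree h.
Proof.
move=> /top_monomials_gt0/eq_bigmax_cond-/(_ (fun m => m.2 : nat))[[i j]].
by rewrite inE /= => /andP[/eqP E nz] Ec; exists i; rewrite [c1 h]Ec.
Qed.

Lemma c1'_attained h : h != 0 ->
  exists2 k, bicoef h (c1' h) k != 0 & (c1' h + k)%N = total_degree h.
Proof.
move=> /top_monomials_gt0/eq_bigmax_cond-/(_ (fun m => m.1 : nat))[[i j]].
by rewrite inE /= => /andP[/eqP E nz] Ec; exists j; rewrite [c1' h]Ec.
Qed.

(** A second leading monomial selects the branch of [alpha_c1] and [alpha_c1'] in which c2 and c2'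
    occur. *)
Lemma card_top_monomials_gt1 h l k l' k' :
  bicoef h l k != 0 -> (l + k)%N = total_degree h ->
  bicoef h l' k' != 0 -> (l' + k')%N = total_degree h -> k != k' ->
  (1 < #|top_monomials h|)%N.
Proof.
move=> nz E nz' E' neq; apply/card_gt1P.
exists (inord l, inord k), (inord l', inord k').
split; try exact: top_monomials_mem.
by apply: contra neq => /eqP[_ /(congr1 val)]; rewrite /= !inordK; lia.
Qed.

(** For c = c1 the distinguished monomial is the leading one with the largest power of z. Its
    zbar-exponent l0 is at most c1' <= c1, so both exponents plus alpha stay within r. Any other
    leading monomial has k <= c2 <= c1 - alpha, hence l >= l0 + alpha. The case c = c1' is
    symmetric. *)
Lemma is_alpha_c_lead r h alpha : (size h <= r)%N -> (sizeY h <= r)%N ->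
    is_alpha_c r h alpha -> exists l0 k0, alpha = 0%N \/
    [/\ bicoef h l0 k0 != 0, (l0 + alpha <= r)%N, (k0 + alpha <= r)%N
      & forall l k, bicoef h l k != 0 -> (l != l0) || (k != k0) ->
          (l + k < l0 + k0)%N \/
          (l + k = l0 + k0)%N /\ ((l0 + alpha <= l)%N \/ (k0 + alpha <= k)%N)].
Proof.
move=> szh szYh; rewrite /is_alpha_c; case: eqVneq => [_ ->|h0]; first by exists 0%N, 0%N; left.
case=> -[Ec Ealpha].
- have [l0 nz0 E0] := c1_attained h0; have [lt_l0 lt_c1] := bicoef_size nz0.
  have le_l0 := leq_c1' nz0 E0.
  have le_a : (alpha <= r - c1 h)%N.
    by rewrite Ealpha /alpha_c1; case: ifP => // _; apply: geq_minl.
  exists l0, (c1 h); right; split => //; try lia.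
  move=> l k nz neq; have := leq_total_degree nz; rewrite leq_eqVlt => /orP[/eqP E|]; last by lia.
  (* Distinct monomials of equal total degree differ in their power of z. *)
  right; split; [lia|left]; have neq_k : k != c1 h by lia.
  have := leq_c1 nz E; have := leq_c2 nz E neq_k.
  have : (alpha <= c1 h - c2 h)%N.
    by rewrite Ealpha /alpha_c1 (card_top_monomials_gt1 nz E nz0 E0) // geq_minr.
  lia.
- have [k0 nz0 E0] := c1'_attained h0; have [lt_c1' lt_k0] := bicoef_size nz0.
  have le_k0 := leq_c1 nz0 E0.
  have le_a : (alpha <= r - c1' h)%N.
    by rewrite Ealpha /alpha_c1'; case: ifP => // _; apply: geq_minl.
  exists (c1' h), k0; right; split => //; try lia.
  move=> l k nz neq; have := leq_total_degree nz; rewrite leq_eqVlt => /orP[/eqP E|]; last by lia.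
  right; split; [lia|right]; have neq_l : l != c1' h by lia.
  have := leq_c1' nz E; have := leq_c2' nz E neq_l.
  have : (alpha <= c1' h - c2' h)%N.
    rewrite Ealpha /alpha_c1' (card_top_monomials_gt1 nz E nz0 E0) ?geq_minr //; lia.
  lia.
Qed.

End Reduction.

(** * Lagrange interpolation on the grid (lambda_i, conj lambda_j) *)

Section Interpolation.
Variables (C : numClosedFieldType) (n : nat) (lambda : 'I_n -> C).
Hypothesis lambda_inj : injective lambda.
Implicit Types (p q : {poly {poly C}}) (gamma : nat -> nat -> C).

Definition lagrange_poly (i : 'I_n) : {poly C} :=
  \prod_(j < n | j != i) ((lambda i - lambda j)^-1%:P * ('X - (lambda j)%:P)).

Lemma horner_lagrange_poly i k : (lagrange_poly i).[lambda k] = (i == k)%:R.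
Proof.
rewrite /lagrange_poly horner_prod; have [<-|neq_ik] := eqVneq i k.
  rewrite big1 // => j neq_ji; rewrite !hornerE mulVf // subr_eq0.
  by rewrite (inj_eq lambda_inj) eq_sym.
by rewrite (bigD1 k) 1?eq_sym //= !hornerE subrr mulr0 mul0r.
Qed.

(** The difference vanishes at the n distinct points, hence is divisible by the product of the
    linear factors. *)
Lemma lagrange_interpolation (p : {poly C}) : exists s,
  p - \sum_(i < n) p.[lambda i]%:P * lagrange_poly i =
  s * \prod_(i < n) ('X - (lambda i)%:P).
Proof.
suff /dvdpP[s Es] : \prod_(x <- [seq lambda i | i <- enum 'I_n]) ('X - x%:P) %|
    p - \sum_(i < n) p.[lambda i]%:P * lagrange_poly i.
  by exists s; rewrite Es big_map big_enum.
apply: uniq_roots_dvdp; last by rewrite uniq_rootsE map_inj_uniq ?enum_uniq.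
apply/allP => _ /mapP[k _ ->]; rewrite rootE hornerD hornerN horner_sum (bigD1 k) //=.
rewrite hornerM hornerC horner_lagrange_poly eqxx mulr1 big1 ?addr0 ?subrr // => i neq.
by rewrite hornerM horner_lagrange_poly (negPf neq) mulr0.
Qed.

(** The factors are a Lagrange polynomial in z and a conjugated one in zbar; [map_poly polyC] embeds
    C[z] into C[z, zbar]. *)
Definition bilagrange (i j : 'I_n) : {poly {poly C}} :=
  map_poly polyC (lagrange_poly i) * conj_bipoly (map_poly polyC (lagrange_poly j)).

Lemma horner2_map_polyC (p : {poly C}) (x y : C) : (map_poly polyC p).[x, y] = p.[x].
Proof. by rewrite horner_map /= hornerC. Qed.

Lemma horner2_bilagrange i j a b :
  (bilagrange i j).[lambda a, (lambda b)^*] = ((i == a) && (j == b))%:R.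
Proof.
rewrite !hornerM horner2_conj !horner2_map_polyC conjCK !horner_lagrange_poly.
by rewrite conjC_nat -natrM mulnb.
Qed.

Lemma horner2Z c q (x y : C) : (c%:P%:P * q).[x, y] = c * q.[x, y].
Proof. by rewrite hornerM hornerC hornerM hornerC. Qed.

Lemma horner2_sum I (s : seq I) (B : pred I) (F : I -> {poly {poly C}}) (x y : C) :
  (\sum_(i <- s | B i) F i).[x, y] = \sum_(i <- s | B i) (F i).[x, y].
Proof. by rewrite !horner_sum. Qed.

Lemma bipoly_interpolation (F : 'I_n -> 'I_n -> C) :
  exists q, forall a b, q.[lambda a, (lambda b)^*] = F a b.
Proof.
exists (\sum_i \sum_j (F i j)%:P%:P * bilagrange i j) => a b.
rewrite horner2_sum (bigD1 a) //= horner2_sum (bigD1 b) //=.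
rewrite horner2Z horner2_bilagrange !eqxx mulr1.
rewrite big1 ?addr0 => [|j neq]; last first.
  by rewrite horner2Z horner2_bilagrange (negPf neq) andbF mulr0.
rewrite big1 ?addr0 // => i neq; rewrite horner2_sum big1 // => j _.
by rewrite horner2Z horner2_bilagrange (negPf neq) mulr0.
Qed.

(** Modulo the ideal, z^k equals its interpolant [A k] and, by conjugation, zbar^l equals the
    conjugate of [A l]; so zbar^l z^k is congruent to a combination of the [bilagrange i j] with its
    values on the grid as coefficients. *)
Lemma riesz_interpolation gamma : (forall i j, gamma j i = (gamma i j)^*) ->
    characteristic_poly gamma (\prod_(i < n) ('X - (lambda i)%:P%:P)) ->
  forall q, riesz gamma q =
    \sum_i \sum_j riesz gamma (bilagrange i j) * q.[lambda i, (lambda j)^*].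
Proof.
move=> gC cQ; elim/bipoly_ind => [|p q Ep Eq|c l k].
- by rewrite riesz0 big1 // => i _; rewrite big1 // => j _; rewrite !horner0 mulr0.
- rewrite rieszD Ep Eq -big_split; apply: eq_bigr => i _ /=; rewrite -big_split.
  by apply: eq_bigr => j _; rewrite !hornerD mulrDr.
have cX m : characteristic_poly gamma ('X^m -
    \sum_i (lambda i ^+ m)%:P%:P * map_poly polyC (lagrange_poly i)).
  have [s] := lagrange_interpolation 'X^m => /(congr1 (map_poly polyC)).
  rewrite rmorphB rmorphM rmorph_sum rmorph_prod /= map_polyXn.
  under [X in _ - X = _]eq_bigr do rewrite rmorphM /= map_polyC /= hornerXn.
  under [X in _ = _ * X]eq_bigr do rewrite rmorphB /= map_polyC map_polyX /=.
  by move=> ->; apply: characteristicM.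
set A := fun m => \sum_i (lambda i ^+ m)%:P%:P * map_poly polyC (lagrange_poly i) in cX.
have cY : characteristic_poly gamma ('Y ^+ l - conj_bipoly (A l)).
  have := characteristic_conj gC (cX l); rewrite conj_bipolyB.
  by have := conj_bimon C 0 l; rewrite /bimon !expr0 mul1r mulr1 => ->.
have EA : bimon C l k - A k * conj_bipoly (A l) =
    'Y ^+ l * ('X^k - A k) + A k * ('Y ^+ l - conj_bipoly (A l)).
  by rewrite !mulrBr addrA [A k * 'Y ^+ l]mulrC subrK.
have /characteristicP/(_ 1) : characteristic_poly gamma (bimon C l k - A k * conj_bipoly (A l)).
  by rewrite EA; apply: characteristicD; apply: characteristicM.
rewrite mulr1 rieszD rieszN => /(canRL (subrK _)); rewrite add0r rieszZ => ->.
rewrite /A mulr_suml riesz_sum mulr_sumr; apply: eq_bigr => i _.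
rewrite conj_bipoly_sum [X in riesz _ X]mulr_sumr riesz_sum mulr_sumr; apply: eq_bigr => j _.
(* The scalar is viewed as a multiple of the monomial 1, so that conjugation of monomials applies to
   it. *)
rewrite -[(lambda j ^+ l)%:P%:P]mulr1 -bimon00 conj_bipolyM conj_bipoly_bimon bimon00 mulr1.
rewrite mulrACA -!rmorphM rieszZ horner2_bimon.
by rewrite [RHS]mulrC mulrA rmorphXn [_ ^+ l * _]mulrC.
Qed.

(** The indicator of (i, i) gives W_ii >= 0. The function equal to 1 at (i, j), c at (j, i) and 0
    elsewhere gives W_ij conj(c) + W_ji c >= 0; replacing c by -c makes this zero, and c = 1 and c =
    i then force W_ij = 0. *)
Lemma diagonal_weights (W : 'I_n -> 'I_n -> C) :
    (forall F : 'I_n -> 'I_n -> C, 0 <= \sum_i \sum_j W i j * (F i j * (F j i)^*)) ->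
  (forall i, 0 <= W i i) /\ (forall i j, i != j -> W i j = 0).
Proof.
move=> Wge0; split=> [i|i j neq].
  have := Wge0 (fun a b => ((a == i) && (b == i))%:R).
  rewrite (bigD1 i) //= (bigD1 i) //= !eqxx conjC1 !mulr1.
  rewrite big1 ?addr0 => [|b neq]; last by rewrite (negPf neq) andbF mul0r mulr0.
  by rewrite big1 ?addr0 // => a neq; rewrite big1 // => b _; rewrite (negPf neq) mul0r mulr0.
have pair_ge0 c : 0 <= W i j * c^* + W j i * c.
  have := Wge0 (fun a b => if (a, b) == (i, j) then 1 else if (a, b) == (j, i) then c else 0).
  have neq' : ((j, i) == (i, j)) = false by rewrite xpair_eqE eq_sym (negPf neq).
  rewrite pair_big /= (bigD1 (i, j)) //= (bigD1 (j, i)) /= ?neq' //.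
  rewrite !eqxx big1 => [|[a b] /andP[/negPf n1 /negPf n2] /=]; last first.
    by rewrite n1 n2 mul0r mulr0.
  by rewrite conjC1 mul1r mulr1 addr0.
have pair0 c : W i j * c^* + W j i * c = 0.
  apply/eqP; rewrite eq_le pair_ge0 andbT -oppr_ge0.
  by have := pair_ge0 (- c); rewrite rmorphN !mulrN -opprD.
have := pair0 'i; have := pair0 1; rewrite conjC1 !mulr1 conjCi => /eqP.
rewrite addr_eq0 => /eqP ->; rewrite mulrN mulNr opprK -mulr2n => /eqP.
by rewrite mulrn_eq0 /= mulf_eq0 (negPf (neq0Ci _)) orbF => /eqP ->; rewrite oppr0.
Qed.

Lemma riesz_diagonal gamma : (forall i j, gamma j i = (gamma i j)^*) ->
    characteristic_poly gamma (\prod_(i < n) ('X - (lambda i)%:P%:P)) ->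
    (forall q, 0 <= riesz gamma (q * conj_bipoly q)) ->
  exists2 w : 'I_n -> C, (forall i, 0 <= w i)
    & forall l k, gamma l k = \sum_i w i * ((lambda i)^* ^+ l * lambda i ^+ k).
Proof.
move=> gC cQ ge0; have E := riesz_interpolation gC cQ.
pose W i j := riesz gamma (bilagrange i j).
have [W0 Wd] : (forall i, 0 <= W i i) /\ (forall i j, i != j -> W i j = 0).
  apply: diagonal_weights => F; have [q Eq] := bipoly_interpolation F.
  suff <- : riesz gamma (q * conj_bipoly q) =
    \sum_i \sum_j W i j * (F i j * (F j i)^*) by apply: ge0.
  (* At (lambda_i, conj lambda_j) the conjugate of q is the conjugate of q(lambda_j, conj lambda_i),
     whence the swapped indices. *)
  rewrite E; apply: eq_bigr => i _; apply: eq_bigr => j _; congr (_ * _).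
  by rewrite !hornerM horner2_conj conjCK !Eq.
exists (fun i => W i i) => // l k.
rewrite -riesz_bimon E; apply: eq_bigr => i _.
rewrite (bigD1 i) //= big1 ?addr0 => [|j neq]; last first.
  by rewrite -[riesz _ _]/(W i j) Wd ?mul0r // eq_sym.
by congr (_ * _); rewrite -[bimon C l k]mul1r -[1]/(1%:P%:P) horner2_bimon mul1r.
Qed.

End Interpolation.

(** * Integration of complex-valued functions *)

Section ReIm.
Variable R : realType.
Implicit Types z t : R[i].

Lemma complex_ReD z t : complex.Re (z + t) = complex.Re z + complex.Re t.
Proof. by case: z t => ? ? []. Qed.

Lemma complex_ImD z t : complex.Im (z + t) = complex.Im z + complex.Im t.
Proof. by case: z t => ? ? []. Qed.

Lemma complex_ReB z t : complex.Re (z - t) = complex.Re z - complex.Re t.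
Proof. by case: z t => ? ? []. Qed.

Lemma complex_ImB z t : complex.Im (z - t) = complex.Im z - complex.Im t.
Proof. by case: z t => ? ? []. Qed.

Lemma complex_ReM z t :
  complex.Re (z * t) = complex.Re z * complex.Re t - complex.Im z * complex.Im t.
Proof. by case: z t => ? ? []. Qed.

Lemma complex_ImM z t :
  complex.Im (z * t) = complex.Re z * complex.Im t + complex.Im z * complex.Re t.
Proof. by case: z t => ? ? []. Qed.

Lemma normc_ge_Im z : `|complex.Im z|%:C%C <= `|z|.
Proof.
have -> : complex.Im z = complex.Re (- 'i * z) by rewrite complex_ReM /=; lra.
by apply: le_trans (normc_ge_Re _) _; rewrite normrM normrN normCi mul1r.
Qed.

End ReIm.

Section ComplexIntegral.
Variables (R : realType) (mu : {measure set (borelC R) -> \bar R}).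
Implicit Types (f g : R[i] -> R[i]) (I J c : R[i]).

Lemma is_complex_integral0 : is_complex_integral mu (fun=> 0) 0.
Proof.
by split; [exact: integrable0 | exact: integrable0 | rewrite !Rintegral_cst //= !mul0r].
Qed.

Lemma is_complex_integralD f g I J :
  is_complex_integral mu f I -> is_complex_integral mu g J ->
  is_complex_integral mu (fun w => f w + g w) (I + J).
Proof.
move=> [fr fi ->] [gr gi ->]; split.
- by under eq_fun do rewrite complex_ReD EFinD; apply: integrableD.
- by under eq_fun do rewrite complex_ImD EFinD; apply: integrableD.
- under [X in _ = (X +i* _)%C]eq_Rintegral do rewrite complex_ReD.
  under [X in _ = (_ +i* X)%C]eq_Rintegral do rewrite complex_ImD.
  by rewrite !RintegralD.
Qed.

Lemma is_complex_integralZ c f I : is_complex_integral mu f I ->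
  is_complex_integral mu (fun w => c * f w) (c * I).
Proof.
move=> [fr fi ->].
have iZ (k : R) (h : borelC R -> R) : mu.-integrable setT (EFin \o h) ->
    mu.-integrable setT (EFin \o (fun w => k * h w)).
  by move=> ih; rewrite /comp; under eq_fun do rewrite EFinM; apply: integrableZl.
split.
- by under eq_fun do rewrite complex_ReM EFinB; apply: integrableB => //; apply: iZ.
- by under eq_fun do rewrite complex_ImM EFinD; apply: integrableD => //; apply: iZ.
- under [X in _ = (X +i* _)%C]eq_Rintegral do rewrite complex_ReM.
  under [X in _ = (_ +i* X)%C]eq_Rintegral do rewrite complex_ImM.
  rewrite RintegralB ?RintegralD ?RintegralZl //; try exact: iZ.
  by case: c.
Qed.

Lemma is_complex_integral_ge0 f I :
  is_complex_integral mu f I -> (forall w, 0 <= f w) -> 0 <= I.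
Proof.
move=> [_ _ ->] f0; rewrite lecE /=; apply/andP; split.
  rewrite (_ : Rintegral _ _ _ = 0) //; under eq_Rintegral => w _.
    move: (f0 w); rewrite lecE => /andP[/eqP -> _] /=; over.
  by rewrite Rintegral_cst // mul0r.
by apply: Rintegral_ge0 => w _; move: (f0 w); rewrite lecE => /andP[].
Qed.

(** A nonnegative function with integral zero vanishes almost everywhere, and so does any g
    vanishing wherever it does. *)
Lemma is_complex_integral_supp f g J :
    is_complex_integral mu f 0 -> (forall w, 0 <= f w) ->
    is_complex_integral mu g J -> (forall w, f w = 0 -> g w = 0) -> J = 0.
Proof.
move=> [fr fi [Efr _]] f0 [gr gi ->] fg.
have f0' w : 0 <= complex.Re (f w) by move: (f0 w); rewrite lecE => /andP[].
have : ae_eq mu setT (fun w : borelC R => (complex.Re (f w))%:E) (cst 0%E).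
  have [mf _] := integrableP _ _ _ fr.
  apply/ae_eq_integral_abs => //.
  under eq_integral do rewrite gee0_abs ?lee_fin //.
  rewrite -[LHS]fineK; last exact: integrable_fin_num.
  by rewrite -[fine _]Efr.
have ae (h : R[i] -> R) : mu.-integrable setT (fun w : borelC R => (h w)%:E) ->
  (forall w, g w = 0 -> h w = 0) ->
  ae_eq mu setT (fun w : borelC R => (complex.Re (f w))%:E) (cst 0%E) ->
  Rintegral mu setT (fun w : borelC R => h w) = 0.
  move=> ih gh aef; rewrite /Rintegral (@ae_eq_integral _ _ _ mu setT (cst 0%E)) //.
  - by rewrite integral0.
  - by case/integrableP: ih.
  (* Only Re f = 0 is known almost everywhere; Im f = 0 comes from f >= 0 in the order of C. *)
  - apply: filterS aef => w /= /(_ Logic.I) [Ef] _; rewrite gh // fg //.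
    by move: (f0 w); rewrite lecE; case: (f w) Ef => x y /= -> /andP[/eqP->].
move=> aef; rewrite !ae //; by move=> w ->.
Qed.

Lemma is_complex_integral_bipoly (gamma : nat -> nat -> R[i]) (p : {poly {poly R[i]}}) :
    (forall i j, is_complex_integral mu (fun w => w^* ^+ i * w ^+ j) (gamma i j)) ->
  is_complex_integral mu (eval_bipoly p) (riesz gamma p).
Proof.
move=> mom; elim/bipoly_ind: p => [|p q Ep Eq|c l k].
- rewrite riesz0 (_ : eval_bipoly 0 = fun=> 0); first exact: is_complex_integral0.
  by apply/funext => w; rewrite /eval_bipoly !horner0.
- rewrite rieszD (_ : eval_bipoly _ = fun w => eval_bipoly p w + eval_bipoly q w).
    exact: is_complex_integralD.
  by apply/funext => w; rewrite /eval_bipoly !hornerD.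
- rewrite rieszZ riesz_bimon (_ : eval_bipoly _ = fun w => c * (w^* ^+ l * w ^+ k)).
    exact: is_complex_integralZ.
  by apply/funext => w; rewrite eval_bipoly_bimon.
Qed.

End ComplexIntegral.

(** * Finite atomic measures *)

Section DiracSum.
Context d (T : measurableType d) (R : realType).
Variables (N : nat) (p : nat -> T) (w : nat -> {nonneg R}).

(** Points and weights are sequences over [nat], as [msum] expects; only the first [N] terms
    count. *)
Definition dirac_sum := msum (fun k => mscale (w k) (dirac (p k)) : {measure set T -> \bar R}) N.

HB.instance Definition _ := Measure.on dirac_sum.

Lemma ge0_integral_dirac_sum (f : T -> \bar R) : measurable_fun setT f ->
    (forall x, 0 <= f x)%E ->
  (\int[dirac_sum]_x f x = \sum_(k < N) (w k)%:num%:E * f (p k))%E.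
Proof.
move=> mf f0; rewrite ge0_integral_measure_sum //; apply: eq_bigr => k _.
by rewrite ge0_integral_mscale // integral_dirac // diracT mul1e.
Qed.

Lemma integrable_dirac_sum (f : T -> R) : measurable_fun setT f ->
  dirac_sum.-integrable setT (EFin \o f).
Proof.
move=> mf; apply/integrableP; split; first exact/measurable_EFinP.
rewrite ge0_integral_dirac_sum //; last exact/measurableT_comp/measurable_EFinP.
under eq_bigr do rewrite /= -EFinM.
by rewrite sumEFin ltry.
Qed.

Lemma Rintegral_dirac_sum (f : T -> R) : measurable_fun setT f ->
  Rintegral dirac_sum setT f = \sum_(k < N) (w k)%:num * f (p k).
Proof.
move=> mf; have mf' : measurable_fun setT (EFin \o f) by exact/measurable_EFinP.
(* The nonnegative case applies to both parts of f, and max(x, 0) - max(-x, 0) = x recombines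
   them. *)
rewrite /Rintegral integralE !ge0_integral_dirac_sum //; last 2 first.
- exact: measurable_funeneg.
- exact: measurable_funepos.
under eq_bigr do rewrite funeposE -EFin_max -EFinM.
under [X in (_ - X)%E]eq_bigr do rewrite funenegE -EFinN -EFin_max -EFinM.
rewrite !sumEFin /= -sumrB; apply: eq_bigr => k _; rewrite -mulrBr; congr (_ * _).
by rewrite !maxr_absE !subr0 normrN; lra.
Qed.

End DiracSum.

(** * Borel measurability on the complex plane *)

Section BorelComplex.
Variable R : realType.

(** A 1-Lipschitz function pulls the ray above a back to an open set: around z the ball of radius
    h(z) - a stays inside. *)
Lemma measurable_borelC (h : R[i] -> R) : (forall z t, `|h z - h t|%:C%C <= `|z - t|) ->
  measurable_fun setT (h : borelC R -> R).
Proof.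
move=> lip; apply: (measurability _ (RGenOInfty.measurableE R)) => //.
move=> _ [_ [a ->] <-]; rewrite setTI; apply: sub_sigma_algebra.
rewrite preimage_itvoy /=; move=> z /= lt_a.
apply/nbhs_ballP; exists (h z - a)%:C%C; first by rewrite /= ltcR subr_gt0.
move=> t; rewrite -ball_normE /= => lt_t.
have := le_lt_trans (lip z t) lt_t; rewrite ltcR.
by move=> /(le_lt_trans (ler_norm _)); rewrite ltrD2l ltrN2.
Qed.

(** Functions with measurable real and imaginary parts are closed under products, and contain the
    identity and conjugation. *)
Lemma measurable_conjX_mulX (i j : nat) :
  measurable_fun setT ((fun w => complex.Re (w^* ^+ i * w ^+ j)) : borelC R -> R) /\
  measurable_fun setT ((fun w => complex.Im (w^* ^+ i * w ^+ j)) : borelC R -> R).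
Proof.
pose mC (f : R[i] -> R[i]) :=
  measurable_fun setT ((fun w => complex.Re (f w)) : borelC R -> R) /\
  measurable_fun setT ((fun w => complex.Im (f w)) : borelC R -> R).
have mM f g : mC f -> mC g -> mC (fun w => f w * g w).
  move=> [fr fi] [gr gi]; split.
    under eq_fun do rewrite complex_ReM.
    by apply: measurable_funB; apply: measurable_funM.
  under eq_fun do rewrite complex_ImM.
  by apply: measurable_funD; apply: measurable_funM.
have mX f k : mC f -> mC (fun w => f w ^+ k).
  move=> mf; elim: k => [|k IH]; first by split; exact: measurable_cst.
  by rewrite (_ : (fun _ => _) = fun w => f w * f w ^+ k);
    [exact: mM | apply/funext => w; rewrite exprS].
have mid : mC id.
  split; apply: measurable_borelC => z t; first by rewrite -complex_ReB normc_ge_Re.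
  by rewrite -complex_ImB normc_ge_Im.
have mconj : mC (fun w => w^*).
  case: mid => mr mi; split => /=.
    by move: mr; congr (measurable_fun _ _); apply/funext; case.
  by move/measurable_funN: mi; congr (measurable_fun _ _); apply/funext; case.
exact: (mM _ _ (mX _ i mconj) (mX _ j mid)).
Qed.

End BorelComplex.

(** * The equivalence of the two conditions *)

Lemma eval_bipolyM (C : numClosedFieldType) (p q : {poly {poly C}}) (w : C) :
  eval_bipoly (p * q) w = eval_bipoly p w * eval_bipoly q w.
Proof. by rewrite /eval_bipoly !hornerM. Qed.

Lemma eval_bipoly_sqr_ge0 (C : numClosedFieldType) (p : {poly {poly C}}) (w : C) :
  0 <= eval_bipoly (p * conj_bipoly p) w.
Proof. by rewrite eval_bipolyM eval_conj_bipoly mul_conjC_ge0. Qed.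

Lemma moment_sequence_finite (R : realType) (gamma : nat -> nat -> R[i])
    (n : nat) (lambda w : 'I_n -> R[i]) : (forall i, 0 <= w i) ->
    (forall l k, gamma l k = \sum_i w i * ((lambda i)^* ^+ l * lambda i ^+ k)) ->
  moment_sequence gamma.
Proof.
move=> w0 Egamma.
(* [insub] extends the families from 'I_n to [nat]; the default 0 is never met for k < n. *)
pose atom (k : nat) : borelC R := odflt 0 (omap lambda (insub k)).
(* The absolute value supplies the nonnegative type and changes nothing, since w_i is real and
   nonnegative. *)
pose mass (k : nat) : {nonneg R} :=
  NngNum (normr_ge0 (complex.Re (odflt 0 (omap w (insub k))))).
exists (dirac_sum n atom mass) => l k; have [mr mi] := measurable_conjX_mulX R l k.
split; try exact: integrable_dirac_sum.
rewrite !Rintegral_dirac_sum // Egamma.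
have ReS (F : 'I_n -> R[i]) : complex.Re (\sum_i F i) = \sum_i complex.Re (F i).
  by apply: big_morph => //; apply: complex_ReD.
have ImS (F : 'I_n -> R[i]) : complex.Im (\sum_i F i) = \sum_i complex.Im (F i).
  by apply: big_morph => //; apply: complex_ImD.
apply/eqP; rewrite eq_complex /= ReS ImS; apply/andP; split; apply/eqP;
  apply: eq_bigr => i _; rewrite /atom /= valK /= ?(complex_ReM (w i)) ?(complex_ImM (w i));
  move: (w0 i); rewrite lecE /= => /andP[/eqP-> wr]; rewrite mul0r ger0_norm //.
- by rewrite subr0.
- by rewrite addr0.
Qed.

Theorem theorem15 (R : realType) (gamma : nat -> nat -> R[i])
    (r : nat) (a : nat -> nat -> R[i])
    (n : nat) (lambda : 'I_n -> R[i])
    (h : {poly {poly R[i]}}) (alpha : nat) :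
  let P : {poly {poly R[i]}} := rdis_poly r a in
  let Q : {poly {poly R[i]}} := \prod_(i < n) ('X - (lambda i)%:P%:P) in
  rdis r a gamma ->
  injective lambda ->
  zero_set P = range lambda ->
  (size h <= r)%N ->
  (sizeY h <= r)%N ->
  (exists f1 f2 : {poly {poly R[i]}}, Q = h + f1 * P + f2 * conj_bipoly P) ->
  is_alpha_c r h alpha ->
  let xi := (2 * r - 2 - alpha)%N in
  moment_sequence gamma <->
  characteristic_poly gamma Q /\ psd (moment_matrix xi gamma).
Proof.
move=> P Q rg lambda_inj ZP szh szYh [f1 [f2 EQ]] alphaP xi.
have cP : characteristic_poly gamma P := rdis_characteristic rg.
have [_ gC _] := rg; split=> [[mu mom]|[cQ Mge0]].
- have intE p := is_complex_integral_bipoly p mom.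
  split=> [|v]; last first.
    rewrite -riesz_bipoly_of_col; apply: is_complex_integral_ge0 (intE _) _.
    exact: eval_bipoly_sqr_ge0.
  apply/characteristicP => q.
  (* The integral of |P|^2 is L(P Pbar) = 0, and Q q vanishes wherever P does. *)
  have := intE (P * conj_bipoly P); move/characteristicP: cP => -> intP.
  apply: is_complex_integral_supp intP _ (intE (Q * q)) _.
    exact: eval_bipoly_sqr_ge0.
  move=> w /eqP; rewrite eval_bipolyM eval_conj_bipoly mul_conjC_eq0 => /eqP Pw.
  have [i _ <-] : range lambda w by rewrite -ZP.
  rewrite eval_bipolyM [eval_bipoly Q _](_ : _ = 0) ?mul0r //.
  by rewrite /eval_bipoly /Q (bigD1 i) //= !hornerM hornerXsubC subrr horner0 mul0r.
- have cPc := characteristic_conj gC cP.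
  have ch : characteristic_poly gamma h.
    have -> : h = Q + - (f1 * P) + - (f2 * conj_bipoly P).
      by rewrite EQ [RHS]addrAC !addrK.
    by do 2?[apply: characteristicD] => //; apply: characteristicN; apply: characteristicM.
  have [l0 [k0 lead]] := is_alpha_c_lead szh szYh alphaP.
  have red := bimon_reducible rg ch (leqnn xi) lead.
  (* Every q is congruent to a polynomial of degree at most [xi], on which M(xi) >= 0 decides the
     sign. *)
  have ge0 q : 0 <= riesz gamma (q * conj_bipoly q).
    have [v /(riesz_sqr_congr gC) ->] : reducible gamma xi q.
      elim/bipoly_ind: q => [|p q|c l k]; [exact: reducible0 | exact: reducibleD | ].
      exact: reducibleZ.
    by rewrite riesz_bipoly_of_col; apply: Mge0.
  have [w w0 Egamma] := riesz_diagonal lambda_inj gC cQ ge0.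
  exact: moment_sequence_finite w0 Egamma.
Qed.
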